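(* Let $F$ be a field and let $m(x)=x^3+ax^2+bx+c\in F[x]$ be irreducible. Let $A,B,C\in\mathcal{C}(m)$ be such that both $B-A$ and $C-A$ are invertible. Let $U_1,U_2\in \mathrm{GL}(3,F)$ be such that $B=U_1AU_1^{-1}$ and $C=U_2AU_2^{-1}$. The following are equivalent. (i) $\mathcal{V}(A,B,C)$ is invertible. (ii) $C^2-A^2-(B^2-A^2)(B-A)^{-1}(C-A)$ is invertible. (iii) $[U_2,A]A[U_2,A]^{-1}-[U_1,A]A[U_1,A]^{-1}$ is invertible.
   Context: $M_3(F)$ is the ring of $3\times 3$ matrices over $F$, and $\mathrm{GL}(3,F)$ is its group of invertible elements. $\mathcal{C}(m)$ is the set of all $A\in M_3(F)$ whose minimal polynomial is $m$. $\mathcal{V}(A,B,C)$ denotes the $9\times 9$ block Vandermonde matrix $\begin{bmatrix} I&I&I\\ A&B&C\\ A^2&B^2&C^2\end{bmatrix}$, where $I$ is the $3\times 3$ identity matrix. $[X,Y]=XY-YX$ is the additive commutator; for $U\in\mathrm{GL}(3,F)$, $UAU^{-1}-A=[U,A]U^{-1}$, so $[U,A]$ is invertible if and only if $UAU^{-1}-A$ is (in particular the inverses in (iii) exist). *)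

(* Defs.v *)
From mathcomp Require Import all_boot all_order all_algebra.

Set Implicit Arguments.
Unset Strict Implicit.
Unset Printing Implicit Defensive.

Import GRing.Theory.
Local Open Scope ring_scope.

Definition minpoly_class (F : fieldType) (m : {poly F}) : {pred 'M[F]_3} :=
  [pred A | mxminpoly A == m].

(* The dimension 3 + (3 + 3) is convertible to 9. *)
Definition block_Vandermonde (F : fieldType) (A B C : 'M[F]_3) :
    'M[F]_(3 + (3 + 3)) :=
  col_mx         (row_mx 1%:M     (row_mx 1%:M     1%:M))
         (col_mx (row_mx A        (row_mx B        C))
                 (row_mx (A ^+ 2) (row_mx (B ^+ 2) (C ^+ 2)))).

Definition add_commutator (R : pzRingType) (x y : R) : R := x * y - y * x.

(* Main.v *)
(* Block elimination turns the Vandermonde matrix into the Schur complement in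
   (ii). With D = B - A and K = [U1, A] = D U1, both
   B^2 - A^2 = A D + D B  and  D B D^-1 = K A K^-1  hold, so that
   (B^2 - A^2) D^-1 = A + K A K^-1. The same holds for C, hence the matrix in
   (ii) is the one in (iii) times C - A. *)
Require Import Defs.
From mathcomp Require Import all_boot all_order all_algebra.

Set Implicit Arguments.
Unset Strict Implicit.
Unset Printing Implicit Defensive.

Import GRing.Theory.
Local Open Scope ring_scope.

(** Block LU factorisation: the lower factor is unitriangular, so the determinant is that of [P]
    times that of the Schur complement. *)
Lemma unitmx_Schur (F : fieldType) (n1 n2 : nat) (P : 'M[F]_n1)
    (Q : 'M[F]_(n1, n2)) (R : 'M[F]_(n2, n1)) (S : 'M[F]_n2) :
  P \in unitmx ->
  (block_mx P Q R S \in unitmx) = (S - R *m invmx P *m Q \in unitmx).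
Proof.
move=> Pu.
have -> : block_mx P Q R S =
    block_mx 1%:M 0 (R *m invmx P) 1%:M *m
    block_mx P Q 0 (S - R *m invmx P *m Q).
  rewrite mulmx_block !mul1mx !mul0mx !addr0 -mulmxA mulVmx //.
  by rewrite mulmx1 addrC subrK.
rewrite !unitmxE det_mulmx det_lblock det_ublock !det1 !mul1r unitrM.
by rewrite -(unitmxE P) Pu.
Qed.

Lemma block_Vandermonde_unit (F : fieldType) (A B C : 'M[F]_3) :
  B - A \in unitmx ->
  (block_Vandermonde A B C \in unitmx) =
  (C ^+ 2 - A ^+ 2 - (B ^+ 2 - A ^+ 2) * (B - A)^-1 * (C - A) \in unitmx).
Proof.
move=> BAu.
have -> : block_Vandermonde A B C =
    block_mx 1%:M (row_mx 1%:M 1%:M) (col_mx A (A ^+ 2))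
      (block_mx B C (B ^+ 2) (C ^+ 2)).
  rewrite /block_Vandermonde [RHS]block_mxEv; congr col_mx.
  by rewrite -[LHS]block_mxEv block_mxEh -block_mxEv.
(* The pivot [1%:M] leaves the 2 by 2 block matrix with rows B - A, C - A and B^2 - A^2, C^2 - A^2;
   its own pivot is B - A. *)
rewrite unitmx_Schur ?unitmx1 // invmx1 mulmx1 mul_col_row !mulmx1.
by rewrite opp_block_mx add_block_mx unitmx_Schur.
Qed.

Lemma sqr_diff_divr (R : unitRingType) (x y u : R) :
  u \is a GRing.unit -> y = u * x * u^-1 -> y - x \is a GRing.unit ->
  (y ^+ 2 - x ^+ 2) / (y - x) =
  x + add_commutator u x * x * (add_commutator u x)^-1.
Proof.
move=> Uu yE Du.
have yuE : y * u = u * x by rewrite yE mulrVK.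
have KE : add_commutator u x = (y - x) * u.
  by rewrite /add_commutator mulrBl yuE.
have -> : add_commutator u x * x * (add_commutator u x)^-1 =
    (y - x) * y / (y - x).
  (* With D = y - x, K x = D u x = D y u, and this last u cancels against K^-1 = u^-1 D^-1. *)
  by rewrite KE invrM // -(mulrA _ u x) -yuE !mulrA mulrK.
(* Clearing D leaves y^2 - x^2 = x (y - x) + (y - x) y, where the terms x y cancel. *)
apply: (mulIr Du); rewrite [RHS]mulrDl !mulrVK // mulrBr mulrBl !expr2.
by rewrite [RHS]addrC addrA subrK.
Qed.

Theorem lemma5p2 (F : fieldType) (a b c : F) (m : {poly F})
  (m_def : m = 'X^3 + a *: 'X^2 + b *: 'X + c%:P)
  (m_irr : irreducible_poly m)
  (A B C : 'M[F]_3)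
  (A_m : A \in minpoly_class m)
  (B_m : B \in minpoly_class m)
  (C_m : C \in minpoly_class m)
  (BA_unit : B - A \in unitmx)
  (CA_unit : C - A \in unitmx)
  (U1 U2 : 'M[F]_3)
  (U1_unit : U1 \in unitmx)
  (U2_unit : U2 \in unitmx)
  (B_def : B = U1 * A * U1^-1)
  (C_def : C = U2 * A * U2^-1) :
  [<-> block_Vandermonde A B C \in unitmx;
       C ^+ 2 - A ^+ 2 - (B ^+ 2 - A ^+ 2) * (B - A)^-1 * (C - A) \in unitmx;
       add_commutator U2 A * A * (add_commutator U2 A)^-1
         - add_commutator U1 A * A * (add_commutator U1 A)^-1 \in unitmx].
Proof.
set schur := C ^+ 2 - _ - _; set comm := _ - _ * _ / add_commutator U1 A.
have schurE : schur = comm * (C - A).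
  rewrite /schur /comm (sqr_diff_divr U1_unit B_def BA_unit).
  (* Writing C^2 - A^2 as a multiple of C - A lets C - A factor out on the right; the summand A
     common to both quotients then cancels. *)
  rewrite -[C ^+ 2 - A ^+ 2](mulrVK CA_unit).
  rewrite (sqr_diff_divr U2_unit C_def CA_unit) -mulrBl; congr (_ * _).
  by rewrite opprD addrACA subrr add0r.
have schur_comm : (schur \in unitmx) = (comm \in unitmx).
  by rewrite schurE unitmx_mul CA_unit andbT.
by rewrite block_Vandermonde_unit // -/schur schur_comm; tfae.
Qed.
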